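(* Assume the Continuum Hypothesis (CH). Then there is a maximal almost disjoint (MAD) family $\mathcal{A}$ that is almost-normal, i.e., whose $\Psi$-space $\Psi(\mathcal{A})$ is an almost-normal topological space.
   Context: An almost disjoint (AD) family is a family $\mathcal{A}$ of infinite subsets of $\omega$ such that $A\cap B$ is finite for all distinct $A,B\in\mathcal{A}$. A MAD family is an infinite AD family that is maximal among AD families with respect to inclusion; equivalently, an infinite AD family such that for every infinite $X\subseteq\omega$ there is $A\in\mathcal{A}$ with $A\cap X$ infinite. The $\Psi$-space (Mrówka-Isbell space) $\Psi(\mathcal{A})$ of an AD family $\mathcal{A}$ has underlying set $\omega\cup\mathcal{A}$ (disjoint union); points of $\omega$ are isolated, and the basic neighborhoods of $A\in\mathcal{A}$ are the sets $\{A\}\cup(A\setminus F)$ with $F\subseteq\omega$ finite. An AD family $\mathcal{A}$ is said to satisfy a topological property iff $\Psi(\mathcal{A})$ does. A subset $C$ of a space $X$ is regular closed if $C=\overline{\mathrm{int}(C)}$. A space $X$ is almost-normal if for every two disjoint closed sets $C,D\subseteq X$, one of which is regular closed, there are disjoint open sets $U,V\subseteq X$ with $C\subseteq U$ and $D\subseteq V$. *)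

(* Defs.v *)
From HB Require Import structures.
From mathcomp Require Import all_boot all_order all_algebra.
From mathcomp Require Import all_classical.
From mathcomp Require Import topology.

Set Implicit Arguments.
Unset Strict Implicit.
Unset Printing Implicit Defensive.

Local Open Scope classical_set_scope.
Local Open Scope card_scope.

(* The continuum is the cardinality of the power set of nat. *)
Definition continuum_hypothesis : Prop :=
  forall S : set (set nat), countable S \/ S #= [set: set nat].

Definition AD_family (F : set (set nat)) : Prop :=
  (forall A, F A -> infinite_set A) /\
  (forall A B, F A -> F B -> A <> B -> finite_set (A `&` B)).

Definition MAD_family (F : set (set nat)) : Prop :=
  [/\ infinite_set F, AD_family F &
      forall G, AD_family G -> F `<=` G -> G = F].

(* The topology makes sense for an arbitrary family F of subsets of nat;
   almost disjointness is a separate hypothesis. *)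
Definition Psi (F : set (set nat)) : Type := (nat + F)%type.

Section Psi_topology.
Variable F : set (set nat).

HB.instance Definition _ := gen_eqMixin (Psi F).
HB.instance Definition _ := gen_choiceMixin (Psi F).

Definition Psi_nbhs (p : Psi F) : set_system (Psi F) :=
  match p with
  | inl n => [set U | U (inl n)]
  | inr A => filter_from [set E : set nat | finite_set E]
      (fun E => [set inr A] `|` [set inl n | n in val A `\` E])
  end.

HB.instance Definition _ := hasNbhs.Build (Psi F) Psi_nbhs.

Let Psi_nbhs_filter (p : Psi F) : ProperFilter (nbhs p).
Proof.
rewrite /nbhs /=; case: p => [n|A].
  split; first by [].
  by split=> [|U V|U V UV] //=; exact: UV.
apply: filter_from_proper; last by move=> E _; exists (inr A); left.
apply: filter_from_filter; first by exists set0; exact: finite_set0.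
move=> E E' Efin E'fin; exists (E `|` E'); first by rewrite /= finite_setU.
move=> _ [->|[n [An /not_orP[nE nE']] <-]]; first by split; left.
by split; right; exists n.
Qed.

Let Psi_nbhs_singleton (p : Psi F) (U : set (Psi F)) : nbhs p U -> U p.
Proof. by case: p => [n|A] //= [E _]; apply; left. Qed.

Let Psi_nbhs_nbhs (p : Psi F) (U : set (Psi F)) :
  nbhs p U -> nbhs p (nbhs^~ U).
Proof.
case: p => [n|A] //= [E Efin EU]; exists E => // _ [->|[n nAE <-]].
  by exists E.
by rewrite /nbhs /=; apply: EU; right; exists n.
Qed.

HB.instance Definition _ := Nbhs_isNbhsTopological.Build (Psi F)
  Psi_nbhs_filter Psi_nbhs_singleton Psi_nbhs_nbhs.

End Psi_topology.

Definition almost_normal (T : topologicalType) : Prop :=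
  forall C D : set T, closed C -> closed D -> C `&` D = set0 ->
    regclosed C \/ regclosed D ->
    exists U V : set T,
      [/\ open U, open V, C `<=` U, D `<=` V & U `&` V = set0].

(* Main.v *)
(* By induction of length omega_1 one builds an almost disjoint family A
   together with, for each W, a set P containing W modulo a finite set, such
   that every member of A is almost contained in P or almost disjoint from P,
   the former happening exactly for the members that meet W in an infinite set.
   Almost-normality is the existence of such a P for each W: a regular closed
   set is determined by its trace W on the isolated points.

   What keeps the induction going is a density invariant.  Let I be the ideal
   generated by A and the finite sets, and B the countable Boolean algebra
   containing the sets P chosen so far.  For every Q in B and every pair (W, P),
   if Q meets P in a set outside I then Q meets W in a set outside I.  Thanks to
   it, an ultrafilter of I-positive elements of B always has a pseudo-intersection
   which is almost disjoint from A and meets W for each P in the ultrafilter: it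
   can be added to A.  To find P for a new W, one first adds countably many
   members to A, so that every obstruction to the invariant is witnessed by
   members of A; then P fills a countable gap. *)

Require Import Defs.
From HB Require Import structures.
From mathcomp Require Import all_boot all_order all_algebra.
From mathcomp Require Import all_classical wochoice.
From mathcomp Require Import topology.

Set Implicit Arguments.
Unset Strict Implicit.
Unset Printing Implicit Defensive.

Local Open Scope classical_set_scope.

(** * Infinite sets of naturals and enumerations of countable sets *)

Lemma infinite_set_unbounded (S : set nat) :
  infinite_set S <-> forall m, exists2 n, m <= n & S n.
Proof.
split=> [Sinf m|Sub Sfin].
  apply: contrapT => noS; apply: Sinf; apply: (sub_finite_set _ (finite_II m)).
  by move=> n Sn /=; rewrite ltnNge; apply/negP => mn; apply: noS; exists n.
have /finite_seqP[s Ss] := Sfin.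
have [n /[swap] Sn] := Sub (\max_(i <- s) i).+1.
rewrite ltnNge => /negP; apply; apply: (@leq_bigmax_seq _ _ predT id) => //.
by move: Sn; rewrite Ss.
Qed.

Lemma increasing_transversal (T : nat -> set nat) :
  (forall k, infinite_set (T k)) ->
  exists2 x : nat -> nat, {homo x : i j / i < j} & forall k, T k (x k).
Proof.
move=> Tinf.
have /choice[g gP] : forall km, exists n, km.2 < n /\ T km.1 n.
  move=> [k m] /=; have [n mn Tn] := (infinite_set_unbounded _).1 (Tinf k) m.+1.
  by exists n.
pose x := fix x k := if k is k'.+1 then g (k, x k') else g (0, 0).
exists x; last by case=> [|k]; [have [] := gP (0, 0) | have [] := gP (k.+1, x k)].
by apply: homo_ltn => [? ? ?|k]; [exact: ltn_trans | have [] := gP (k.+1, x k)].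
Qed.

Lemma countable_enum_infinitely_often (T : Type) (X : set T) :
  countable X -> X !=set0 ->
  exists2 e : nat -> T, (forall k, X (e k)) &
    forall x m, X x -> exists2 k, m <= k & e k = x.
Proof.
move=> /countable_injP[f finj] [x0 Xx0].
(* The index [k] lists the element whose code is the 2-adic valuation of [k], so every element
   recurs beyond any bound; [x0] fills the indices whose valuation is not a code. *)
have /choice[e eP] : forall k, exists y, X y /\
    ((exists2 x, X x & f x = logn 2 k) -> f y = logn 2 k).
  move=> k; have [[x Xx fx]|nx] := pselect (exists2 x, X x & f x = logn 2 k).
    by exists x.
  by exists x0.
exists e => [k|x m Xx]; first by have [] := eP k.
exists (2 ^ f x * m.*2.+1).
  rewrite (leq_trans _ (leq_pmull _ _)) ?expn_gt0// -addnn.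
  by rewrite (leq_trans (leq_addr m m)).
have lx : logn 2 (2 ^ f x * m.*2.+1) = f x.
  rewrite lognM ?expn_gt0// pfactorK// logn_coprime ?addn0//.
  by rewrite coprime2n /= odd_double.
have [Xy fy] := eP (2 ^ f x * m.*2.+1).
by apply: finj; rewrite ?inE// fy ?lx//; exists x.
Qed.

Lemma countable_setU (T : Type) (X Y : set T) :
  countable X -> countable Y -> countable (X `|` Y).
Proof.
move=> Xc Yc.
have -> : X `|` Y = \bigcup_(b in [set: bool]) if b then X else Y.
  apply/seteqP; split=> x; first by case; [exists true | exists false].
  by case=> -[] _; [left | right].
by apply: bigcup_countable => // -[].
Qed.

(** * Ideals on the naturals and countable gaps *)

Definition ideal (L : set (set nat)) :=
  [/\ forall S, finite_set S -> L S,
      forall S T, S `<=` T -> L T -> L S &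
      forall S T, L S -> L T -> L (S `|` T)].

(** Ideals contain all finite sets and may be improper, so these are the sets almost covered by
    finitely many members of [G]. Written as an intersection, the definition gives induction by a
    choice of [L]. *)
Definition gen_ideal (G : set (set nat)) : set (set nat) :=
  fun S => forall L, ideal L -> G `<=` L -> L S.

Lemma gen_idealP G : ideal (gen_ideal G).
Proof.
split=> [S Sfin L [Lfin _ _] _|S T ST IT L iL GL|S T IS IT L iL GL].
- exact: Lfin.
- by have [_ Lsub _] := iL; apply: (Lsub _ T) => //; exact: IT.
- by have [_ _ LU] := iL; apply: LU; [exact: IS | exact: IT].
Qed.

Lemma sub_gen_ideal G : G `<=` gen_ideal G.
Proof. by move=> S GS L _; apply. Qed.

Lemma gen_ideal_mono G H : G `<=` H -> gen_ideal G `<=` gen_ideal H.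
Proof.
by move=> GH S; apply; [exact: gen_idealP | exact: subset_trans GH (@sub_gen_ideal _)].
Qed.

Lemma ideal_subU L S T U : ideal L -> S `<=` T `|` U -> L T -> L U -> L S.
Proof. by move=> [_ Lsub LU] STU LT LU'; apply: (Lsub _ _ STU); exact: LU. Qed.

Lemma ideal_sub L S T : ideal L -> S `<=` T -> L T -> L S.
Proof. by move=> [_ + _]; apply. Qed.

Lemma ideal_fin L S : ideal L -> finite_set S -> L S.
Proof. by move=> [+ _ _]; apply. Qed.

Lemma sub_finite_setU (T : Type) (S A B : set T) :
  S `<=` A `|` B -> finite_set A -> finite_set B -> finite_set S.
Proof. by move=> SAB fA fB; apply: (sub_finite_set SAB); rewrite finite_setU. Qed.

Lemma sub_finite_setU3 (T : Type) (S A B C : set T) : S `<=` A `|` B `|` C ->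
  finite_set A -> finite_set B -> finite_set C -> finite_set S.
Proof. by move=> SABC fA fB fC; apply: (sub_finite_set SABC); rewrite !finite_setU. Qed.

Lemma gen_ideal_exhaustion G : countable G -> exists J : nat -> set nat,
  [/\ forall k l, k <= l -> J k `<=` J l, forall k, gen_ideal G (J k) &
      forall S, gen_ideal G S -> exists k, S `<=` J k].
Proof.
move=> Gc.
have Gc' : countable (set0 |` G).
  exact: countable_setU.
have [|e eG eP] := countable_enum_infinitely_often Gc'.
  by exists set0; left.
(* The initial segment below [k] absorbs finite errors, so each member of the ideal is truly
   included in some [J k]. *)
pose J k := [set n | n < k \/ exists2 i, i < k & e i n].
have Jmono k l : k <= l -> J k `<=` J l.
  move=> kl n [nk|[i ik ein]]; first by left; exact: leq_trans kl.
  by right; exists i => //; exact: leq_trans kl.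
exists J; split=> // [k|S IS].
  elim: k => [|k IHk].
    by apply: (ideal_fin (gen_idealP G)); apply: (sub_finite_set _ (finite_set0 _))
      => n [//|[]].
  apply: (ideal_subU (gen_idealP G) (T := J k) (U := [set k] `|` e k)) => //.
    move=> n [|[i]]; rewrite ltnS leq_eqVlt => /predU1P[->|nk].
    - by right; left.
    - by left; left.
    - by right; right.
    - by move=> ein; left; right; exists i.
  have [_ _ LU] := gen_idealP G; apply: LU.
    exact: (ideal_fin (gen_idealP G)).
  have [->|] := eG k; first exact: (ideal_fin (gen_idealP G)).
  exact: sub_gen_ideal.
apply: (IS [set X | exists k, X `<=` J k]) => {S IS}.
  split=> [S Sfin|S T ST [k TJ]|S T [k SJ] [l TJ]].
  - apply: contrapT => nk.
    have /finite_seqP[s Ss] := Sfin.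
    apply: nk; exists (\max_(i <- s) i).+1 => n Sn; left; rewrite ltnS.
    apply: (@leq_bigmax_seq _ _ predT id) => //.
    by move: Sn; rewrite Ss.
  - by exists k; exact: subset_trans TJ.
  - exists (maxn k l) => n [/SJ|/TJ]; apply: Jmono.
      exact: leq_maxl.
    exact: leq_maxr.
move=> S GS; have [k _ eS] := eP S 0 (or_intror GS).
by exists k.+1 => n Sn; right; exists k; rewrite ?eS.
Qed.

(** Enumerate the two sides as [u] and [v], and put [n] in [P] when some [u i] contains it and no
    [v j] with [j <= i] does. Then [u i] loses only points shared with some [v j], [j <= i], and
    [v j] meets [P] only in points shared with some [u i], [i < j]: finitely many finite sets each
    time. *)
Lemma gap_interpolation (U V : set (set nat)) :
  countable U -> countable V ->
  (forall S T, U S -> V T -> finite_set (S `&` T)) ->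
  exists P, (forall S, U S -> finite_set (S `\` P)) /\
            (forall T, V T -> finite_set (T `&` P)).
Proof.
move=> Uc Vc UV.
have [U0|/set0P Un] := eqVneq U set0.
  by exists set0; split=> [S|T _]; rewrite ?U0 ?setI0.
have [V0|/set0P Vn] := eqVneq V set0.
  by exists setT; split=> [S _|T]; rewrite ?V0 ?setDT.
have [u uU uP] := countable_enum_infinitely_often Uc Un.
have [v vV vP] := countable_enum_infinitely_often Vc Vn.
have fin_lt (F : nat -> set nat) k : (forall i, finite_set (F i)) ->
    finite_set [set n | exists2 i, i < k & F i n].
  move=> Ff; have -> : [set n | exists2 i, i < k & F i n] = \bigcup_(i in `I_k) F i.
    by [].
  exact: bigcup_finite.
exists [set n | exists i, u i n /\ forall j, j <= i -> ~ v j n]; split.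
  move=> S /(uP _ 0)[i _ <-].
  apply: (sub_finite_set _ (fin_lt (fun j => u i `&` v j) i.+1 _)) => [n [un nP]|j].
    apply: contrapT => nj; apply: nP; exists i; split=> // j ji vj.
    by apply: nj; exists j.
  exact: UV.
move=> T /(vP _ 0)[j _ <-].
apply: (sub_finite_set _ (fin_lt (fun i => u i `&` v j) j _)) => [n [vn [i [un ni]]]|i].
  by exists i => //; rewrite ltnNge; apply/negP => /ni.
exact: UV.
Qed.

(** * Conditions *)

Ltac set_tauto :=
  let x := fresh in intro x; rewrite /setD /setI /setU /setC /mkset /=; tauto.
Ltac set_tauto_by X :=
  let x := fresh in intro x; have := EM (X x);
  rewrite /setD /setI /setU /setC /mkset /=; tauto.

(* [cond_dense] is the density invariant, in contrapositive form. *)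
Record condition (A : set (set nat)) (Pr : set (set nat * set nat))
    (B : set (set nat)) : Prop := Condition {
  cond_inf : forall a, A a -> infinite_set a;
  cond_ad : forall a b, A a -> A b -> a <> b -> finite_set (a `&` b);
  cond_setT : B setT;
  cond_setI : forall Q R, B Q -> B R -> B (Q `&` R);
  cond_setC : forall Q, B Q -> B (~` Q);
  cond_pairB : forall W P, Pr (W, P) -> B P;
  cond_pair_sub : forall W P, Pr (W, P) -> finite_set (W `\` P);
  cond_pairT : Pr (setT, setT);
  cond_dec : forall a Q, A a -> B Q -> finite_set (a `\` Q) \/ finite_set (a `&` Q);
  cond_hit : forall a W P, A a -> Pr (W, P) ->
    finite_set (a `&` W) -> finite_set (a `&` P);
  cond_dense : forall Q W P, B Q -> Pr (W, P) ->
    gen_ideal A (Q `&` W) -> gen_ideal A (Q `&` P);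
  cond_proper : ~ gen_ideal A setT }.

(** * Adding one member to the family *)

Lemma gen_ideal_setU1 A a S :
  gen_ideal (a |` A) S -> gen_ideal A (S `\` a).
Proof.
have iA := gen_idealP A.
move=> /(_ [set S | gen_ideal A (S `\` a)]); apply.
  split=> [T Tfin|T U TU|T U IT IU].
  - exact: (ideal_fin iA (finite_setD _ Tfin)).
  - exact: (ideal_sub iA (setSD TU)).
  - by apply: (ideal_subU iA _ IT IU); set_tauto.
move=> T [->|AT]; first by rewrite /= setDv; exact: ideal_fin.
by apply: (ideal_sub iA (T := T)); [set_tauto | exact: sub_gen_ideal].
Qed.

(** The sequence [r] generates an ultrafilter of [K]-positive elements of [B]: when a positive set
    is cut in two by [q k], one half is positive because [K] is an ideal. *)
Lemma algebra_decision (B K : set (set nat)) (R : set nat) :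
  countable B -> (forall Q R, B Q -> B R -> B (Q `&` R)) ->
  (forall Q, B Q -> B (~` Q)) -> ideal K -> B R -> ~ K R ->
  exists r : nat -> set nat,
    [/\ r 0 = R, forall k l, k <= l -> r l `<=` r k,
        forall k, B (r k) /\ ~ K (r k) &
        forall Q, B Q -> exists k, r k `<=` Q \/ r k `&` Q = set0].
Proof.
move=> Bc BI BC iK BR KR.
have [q qB qP] := countable_enum_infinitely_often Bc (ex_intro _ _ BR).
pose r := fix r k := if k is k'.+1 then
  (if `[< K (r k' `&` q k') >] then r k' `&` ~` q k' else r k' `&` q k') else R.
exists r; split=> // [k l|k|Q /(qP _ 0)[k _ <-]].
- elim: l => [|l IHl]; first by rewrite leqn0 => /eqP->.
  rewrite leq_eqVlt => /predU1P[->//|/IHl lk] n rn; apply: lk.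
  by move: rn => /=; case: ifP => _ [].
- elim: k => [//|k [Brk Krk]] /=; case: asboolP => Kq; split=> //.
  + exact/BI/BC/qB.
  + move=> Kq'; apply: Krk; apply: (ideal_subU iK _ Kq Kq').
    by set_tauto_by (q k).
  + exact: BI.
- exists k.+1 => /=; case: asboolP => _; [right | left].
    by rewrite -subset0; set_tauto.
  by set_tauto.
Qed.

Section extend.
Variables (A : set (set nat)) (Pr : set (set nat * set nat)) (B : set (set nat)).
Hypothesis cond : condition A Pr B.
Hypotheses (Ac : countable A) (Prc : countable Pr) (Bc : countable B).
(** The new member will follow an ultrafilter of sets outside [K] containing [R], stay inside [Z]
    and meet [Y]. [KY] and [KP] make [K] large enough for [Y], and for the trace on [Z] of each [W]
    whose [P] is in the ultrafilter, to stay positive along it. *)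
Variables (K : set (set nat)) (R Y Z : set nat).
Hypotheses (iK : ideal K) (BR : B R) (KR : ~ K R) (YZ : Y `<=` Z).
Hypothesis KY : forall Q, B Q -> gen_ideal A (Q `&` Y) -> K Q.
Hypothesis KP : forall Q W P, B Q -> Pr (W, P) ->
  gen_ideal A (Q `&` W `&` Z) -> K (Q `&` P).

(* The new set consists of the even-indexed terms of a transversal; the
   odd-indexed ones stay outside of it and keep the positive sets
   [Q `&` W] positive. *)
Lemma condition_extend : exists a,
  [/\ condition (a |` A) Pr B, a `<=` Z, infinite_set (a `&` Y),
      finite_set (a `\` R) & forall S, gen_ideal A S -> finite_set (a `&` S)].
Proof.
have iA := gen_idealP A.
have [J [Jmono JI JP]] := gen_ideal_exhaustion Ac.
have [r [r0 rmono rBK rdec]] := algebra_decision Bc (cond_setI cond)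
  (cond_setC cond) iK BR KR.
have Jinf S k : ~ gen_ideal A S -> infinite_set (S `\` J k).
  by move=> IS Sfin; apply: IS;
    apply: (ideal_subU iA _ (ideal_fin iA Sfin) (JI k)); set_tauto_by (J k).
(* The sets that the new member has to meet infinitely often. *)
pose X := Y |` [set V `&` Z | V in
  [set V | exists P, Pr (V, P) /\ exists k, r k `<=` P]].
have Xc : countable X.
  apply: countable_setU => //.
  have : countable [set wp.1 `&` Z | wp in Pr].
    exact: sub_countable (card_image_le _ _) Prc.
  apply: sub_countable; apply: subset_card_le => _ [W [P [PrWP _]] <-].
  by exists (W, P).
have XP T k : X T -> ~ gen_ideal A (r k `&` T).
  have [Brk Krk] := rBK k.
  move=> [->|[W [P [PrWP [j rj]]] <-]].
    by move=> /(KY Brk).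
  move=> I; have [_ Kr] := rBK (maxn j k); apply: Kr.
  apply: (ideal_sub iK (T := r (maxn j k) `&` P)).
    move=> n rn; split=> //; apply: rj; apply: rmono rn; exact: leq_maxl.
  apply: KP PrWP _; first by have [] := rBK (maxn j k).
  apply: (ideal_sub iA _ I) => n [[rn Wn Zn]]; split=> //.
  by apply: rmono rn; exact: leq_maxr.
have [t tX tP] := countable_enum_infinitely_often Xc (ex_intro _ Y (or_introl erefl)).
(* The positive sets that must remain positive for the density invariant; [setT] is one of them,
   which will give [cond_proper]. *)
pose N := [set S | ~ gen_ideal A S /\ exists Q W P, [/\ B Q, Pr (W, P) & S = Q `&` W]].
have Nc : countable N.
  have : countable [set qw.1 `&` qw.2.1 | qw in B `*` Pr].
    by apply: sub_countable (card_image_le _ _) _; exact: countableX.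
  apply: sub_countable; apply: subset_card_le => _ [_ [Q [W [P [BQ PrWP ->]]]]].
  by exists (Q, (W, P)).
have NT : N setT.
  split; first exact: (cond_proper cond).
  exists setT, setT, setT; split; rewrite ?setIT//; first exact: cond_setT cond.
  exact: cond_pairT cond.
have [s sN sP] := countable_enum_infinitely_often Nc (ex_intro _ _ NT).
(* Removing [J] makes the new member almost disjoint from every set of the ideal and puts the
   reserved odd-indexed points outside it too. *)
pose U k := (if odd k then s k./2 else r k./2 `&` t k./2) `\` J k./2.
have Uinf k : infinite_set (U k).
  apply: Jinf; case: ifP => _; first by have [] := sN k./2.
  exact: XP.
have [x xmono xU] := increasing_transversal Uinf.
have xinj i j : x i = x j -> i = j.
  by case: (ltngtP i j) => // /xmono; rewrite ltn_neqAle => /andP[/eqP + _];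
    move=> /nesym // => h e; case: h.
have xge k : k <= x k.
  by elim: k => // k IHk; exact: leq_ltn_trans IHk (xmono _ _ _).
pose a := [set x k.*2 | k in [set: nat]].
have xe k : U k.*2 = (r k `&` t k) `\` J k by rewrite /U odd_double doubleK.
have xo k : U k.*2.+1 = s k `\` J k by rewrite /U /= odd_double /= uphalf_double.
have aZ : a `<=` Z.
  move=> _ [k _ <-]; have := xU k.*2; rewrite xe => -[[_ +] _].
  by have [->|[W _ <-]] := tX k; [move=> /YZ | case].
have aX T : X T -> infinite_set (a `&` T).
  move=> XT; apply/infinite_set_unbounded => m.
  have [k mk tk] := tP T m XT; exists (x k.*2).
    by apply: leq_trans (xge _); rewrite -addnn; exact: leq_trans (leq_addr _ _).
  split; first by exists k.
  by have := xU k.*2; rewrite xe tk => -[[]].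
have tail (C : set nat) k : (forall l, k <= l -> C (x l.*2)) -> finite_set (a `\` C).
  move=> Ck; apply: (sub_finite_set _ (finite_image (fun l => x l.*2) (finite_II k))).
  move=> _ [[l _ <-] nC]; exists l => //=.
  by rewrite ltnNge; apply/negP => /Ck.
have ar k : finite_set (a `\` r k).
  apply: (tail _ k) => l kl.
  by have := xU l.*2; rewrite xe => -[[+ _] _]; exact: rmono.
have aI S : gen_ideal A S -> finite_set (a `&` S).
  move=> /JP[k SJ]; have : finite_set (a `\` ~` J k).
    apply: (tail _ k) => l kl; have := xU l.*2; rewrite xe => -[_ nJ].
    by move=> /(Jmono _ _ kl).
  by apply: sub_finite_set => n [an Sn]; split=> //; apply; exact: SJ.
have aN S : N S -> ~ gen_ideal A (S `\` a).
  move=> NS /JP[m SJ]; have [k mk sk] := sP S m NS.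
  have := xU k.*2.+1; rewrite xo sk => -[Sx]; apply.
  apply: (Jmono _ _ mk); apply: SJ; split=> // -[l _ /xinj/(congr1 odd)].
  by rewrite /= !odd_double.
exists a; split=> //; last 2 first.
- by apply: aX; left.
- by rewrite -r0.
split.
- move=> b [->|/(cond_inf cond)//].
  by have := aX Y (or_introl erefl); apply: contra_not; exact: finite_setIl.
- move=> b c [->|Ab] [->|Ac'] // bc.
  + by apply: aI; exact: sub_gen_ideal.
  + by rewrite setIC; apply: aI; exact: sub_gen_ideal.
  + exact: (cond_ad cond).
- exact: cond_setT cond.
- exact: cond_setI cond.
- exact: cond_setC cond.
- exact: cond_pairB cond.
- exact: cond_pair_sub cond.
- exact: cond_pairT cond.
- move=> b Q [->|Ab] BQ; last exact: (cond_dec cond).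
  have [k [rQ|rQ]] := rdec Q BQ.
    by left; apply: (sub_finite_set _ (ar k)) => n [an nQ]; split=> // /rQ.
  right; apply: (sub_finite_set _ (ar k)) => n [an Qn]; split=> // rn.
  by have : (r k `&` Q) n by []; rewrite rQ.
- move=> b W P [->|Ab] PrWP; last exact: (cond_hit cond).
  (* If [P] is in the ultrafilter, [a] meets [W] infinitely often by construction; otherwise [a] is
     almost disjoint from [P]. *)
  move=> aW; have [k [rP|rP]] := rdec P (cond_pairB cond PrWP).
    have /aX[] : X (W `&` Z) by right; exists W => //; exists P; split=> //; exists k.
    by apply: (sub_finite_set _ aW); set_tauto.
  apply: (sub_finite_set _ (ar k)) => n [an Pn]; split=> // rn.
  by have : (r k `&` P) n by []; rewrite rP.
- move=> Q W P BQ PrWP IQW.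
  have [IQW'|nIQW] := pselect (gen_ideal A (Q `&` W)).
    have := cond_dense cond BQ PrWP IQW'; apply: gen_ideal_mono.
    by move=> ? ?; right.
  by have /aN[] : N (Q `&` W); [split=> //; exists Q, W, P | exact: gen_ideal_setU1].
- by move=> /gen_ideal_setU1; exact: aN.
Qed.

End extend.

(** * Directed unions and transfinite recursion *)

Lemma gen_ideal_bigcup (I : Type) (D : set I) (A : I -> set (set nat)) S :
  D !=set0 ->
  (forall i j, D i -> D j -> exists2 k, D k & A i `<=` A k /\ A j `<=` A k) ->
  gen_ideal (\bigcup_(i in D) A i) S -> exists2 i, D i & gen_ideal (A i) S.
Proof.
move=> [i0 Di0] dir /(_ [set S | exists2 i, D i & gen_ideal (A i) S]); apply.
  split=> [T Tfin|T U TU [i Di IU]|T U [i Di IT] [j Dj IU]].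
  - by exists i0 => //; exact: (ideal_fin (gen_idealP _)).
  - by exists i => //; exact: (ideal_sub (gen_idealP _) TU).
  - have [k Dk [ik jk]] := dir _ _ Di Dj; exists k => //.
    have [_ _ LU] := gen_idealP (A k).
    by apply: LU; [exact: gen_ideal_mono ik _ IT | exact: gen_ideal_mono jk _ IU].
by move=> T [i Di AiT]; exists i => //; exact: sub_gen_ideal.
Qed.

(** Each clause involves finitely many elements and at most one membership in the ideal, so it can
    be checked at a single index. *)
Lemma condition_bigcup (I : Type) (D : set I) (A B : I -> set (set nat))
    (Pr : I -> set (set nat * set nat)) :
  D !=set0 ->
  (forall i j, D i -> D j -> exists2 k, D k &
    [/\ A i `<=` A k, Pr i `<=` Pr k & B i `<=` B k] /\
    [/\ A j `<=` A k, Pr j `<=` Pr k & B j `<=` B k]) ->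
  (forall i, D i -> condition (A i) (Pr i) (B i)) ->
  condition (\bigcup_(i in D) A i) (\bigcup_(i in D) Pr i) (\bigcup_(i in D) B i).
Proof.
move=> D0 dir cnd; have [i0 Di0] := D0.
have dirA i j : D i -> D j -> exists2 k, D k & A i `<=` A k /\ A j `<=` A k.
  by move=> Di Dj; have [k Dk [[? _ _] [? _ _]]] := dir _ _ Di Dj; exists k.
split.
- by move=> a [i /cnd ci]; exact: cond_inf ci _.
- move=> a b [i Di ai] [j Dj bj]; have [k Dk [[ik _ _] [jk _ _]]] := dir _ _ Di Dj.
  by apply: (cond_ad (cnd _ Dk)); [exact: ik | exact: jk].
- by exists i0 => //; exact: cond_setT (cnd _ Di0).
- move=> Q R [i Di Qi] [j Dj Rj]; have [k Dk [[_ _ ik] [_ _ jk]]] := dir _ _ Di Dj.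
  by exists k => //; apply: (cond_setI (cnd _ Dk)); [exact: ik | exact: jk].
- by move=> Q [i Di Qi]; exists i => //; exact: (cond_setC (cnd _ Di)).
- by move=> W P [i Di WP]; exists i => //; exact: (cond_pairB (cnd _ Di)) WP.
- by move=> W P [i Di WP]; exact: (cond_pair_sub (cnd _ Di)) WP.
- by exists i0 => //; exact: (cond_pairT (cnd _ Di0)).
- move=> a Q [i Di ai] [j Dj Qj]; have [k Dk [[ik _ _] [_ _ jk]]] := dir _ _ Di Dj.
  by apply: (cond_dec (cnd _ Dk)); [exact: ik | exact: jk].
- move=> a W P [i Di ai] [j Dj WPj]; have [k Dk [[ik _ _] [_ jk _]]] := dir _ _ Di Dj.
  by apply: (cond_hit (cnd _ Dk)); [exact: ik | exact: jk].
- move=> Q W P [i Di Qi] [j Dj WPj] /(gen_ideal_bigcup D0 dirA)[l Dl Il].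
  have [k Dk [[_ _ ik] [_ jk _]]] := dir _ _ Di Dj.
  have [m Dm [[km km' km''] [lm _ _]]] := dir _ _ Dk Dl.
  apply: (gen_ideal_mono (bigcup_sup Dm)).
  apply: (cond_dense (cnd _ Dm) (W := W)).
  + exact/km''/ik.
  + exact/km'/jk.
  + exact: gen_ideal_mono Il.
- by move=> /(gen_ideal_bigcup D0 dirA)[l /cnd/cond_proper].
Qed.

(** Stage [i] starts from [p i], the union of [base] and all earlier stages, countable because
    initial segments are, and ends at [p' i]. It serves both for the countable saturation and for
    the main induction. *)
Lemma chain_construction (I T : Type) (lt : I -> I -> Prop)
    (good : set (set T)) (base : set T) (E : I -> set T -> set T -> Prop) :
  well_founded lt -> (forall i j, lt i j \/ i = j \/ lt j i) ->
  (forall i, countable [set j | lt j i]) ->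
  good base -> countable base ->
  (forall C : set (set T), C !=set0 -> C `<=` good ->
    (forall c d, C c -> C d -> c `<=` d \/ d `<=` c) -> good (\bigcup_(c in C) c)) ->
  (forall i c, good c -> countable c ->
    exists c', [/\ good c', countable c', c `<=` c' & E i c c']) ->
  exists p p' : I -> set T,
    [/\ forall i, E i (p i) (p' i),
        forall i, [/\ good (p' i), countable (p' i), base `<=` p i & p i `<=` p' i],
        forall i j, lt i j -> p' i `<=` p j &
        good (base `|` \bigcup_i p' i)].
Proof.
move=> wf tri seg gb cb gU ext.
(* The extension function is total, so the recursion carries no proofs; that its arguments are good
   and countable is shown afterwards, in [main]. *)
have /choice[f fP] : forall ic : I * set T, exists c', good ic.2 -> countable ic.2 ->
    [/\ good c', countable c', ic.2 `<=` c' & E ic.1 ic.2 c'].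
  move=> [i c] /=; have [[gc cc]|n] := pselect (good c /\ countable c).
    by have [c' ?] := ext i c gc cc; exists c'.
  by exists c => gc cc; case: n.
pose body i (rec : forall j, lt j i -> set T) : set T :=
  f (i, base `|` [set x | exists j (ji : lt j i), rec j ji x]).
pose p' : I -> set T := Fix wf (fun=> set T) body.
pose p i := base `|` \bigcup_(j in [set j | lt j i]) p' j.
have p'E i : p' i = f (i, p i).
  rewrite /p' Fix_eq => [|j g h gh]; last first.
    by congr (f (j, base `|` _)); apply/seteqP; split=> x [k [kj]];
      [rewrite gh | rewrite -gh]; exists k, kj.
  congr (f (i, base `|` _)); apply/seteqP; split=> x.
    by move=> [j [ji ?]]; exists j.
  by move=> [j ji ?]; exists j, ji.
have good_union (D : set I) : (forall i, D i -> good (p' i) /\ p i `<=` p' i) ->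
    good (base `|` \bigcup_(i in D) p' i).
  (* Counting [base] as a member of the chain keeps it nonempty at the first stage. *)
  move=> Dg; have -> : base `|` \bigcup_(i in D) p' i =
      \bigcup_(c in base |` [set p' i | i in D]) c.
    by rewrite bigcup_setU1 bigcup_image.
  apply: gU.
  - by exists base; left.
  - by move=> _ [->//|[i /Dg[? _] <-]].
  - have base_sub i : D i -> base `<=` p' i.
      by move=> /Dg[_]; apply: subset_trans => x bx; left.
    move=> _ _ [->|[i Di <-]] [->|[j Dj <-]]; first by left.
    + by left; exact: base_sub.
    + by right; exact: base_sub.
    + have lt_sub k l : D l -> lt k l -> p' k `<=` p' l.
        by move=> /Dg[_] + kl; apply: subset_trans => x px; right; exists k.
      have [ij|[->|ji]] := tri i j; [left|left|right] => //; exact: lt_sub.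
have main i : [/\ good (p' i), countable (p' i), p i `<=` p' i & E i (p i) (p' i)].
  elim/(well_founded_ind wf): i => i IHi.
  rewrite p'E; apply: (fP (i, p i)) => /=.
    by apply: good_union => j /IHi[].
  by apply: countable_setU => //; apply: bigcup_countable => // j /IHi[].
exists p, p'; split=> [i|i|i j ij|].
- by have [] := main i.
- by have [? ? ? _] := main i; split=> // x bx; left.
- by move=> x px; right; exists i.
- by apply: good_union => i _; have [] := main i.
Qed.

(** * Saturating the family with respect to a set *)

(* A set [P] paired with [W] must contain each thin set [G] modulo the ideal:
   otherwise [G `\` P] would violate the invariant for [(W', P')]. *)
Definition thin_sets (A : set (set nat)) (Pr : set (set nat * set nat))
    (B : set (set nat)) (W : set nat) : set (set nat) :=
  [set G | B G /\ exists W' P',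
    [/\ Pr (W', P'), G `<=` P' & gen_ideal A ((G `&` W') `\` W)]].

(** These sets are forced into a partitioner of [W] modulo the ideal of [A]. An [R] in [B] outside
    this ideal leaves room for a new member almost contained in [R] and disjoint from [W]. *)
Definition cover_ideal A Pr B W := gen_ideal (A `|` thin_sets A Pr B W).

Lemma cover_ideal_mono A A' Pr B W : A `<=` A' ->
  cover_ideal A Pr B W `<=` cover_ideal A' Pr B W.
Proof.
move=> AA'; apply: gen_ideal_mono => S [/AA' ?|[BS [W' [P' [? ? I]]]]]; [by left|right].
by split=> //; exists W', P'; split=> //; exact: gen_ideal_mono I.
Qed.

Definition saturation_step (W R : set nat) Pr B (A A' : set (set nat)) :=
  (gen_ideal A' (R `&` W) \/ exists a, [/\ A' a, infinite_set (a `&` (R `&` W)) &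
     forall S, gen_ideal A S -> finite_set (a `&` S)]) /\
  (cover_ideal A' Pr B W R \/ exists a, [/\ A' a, finite_set (a `\` R),
     finite_set (a `&` W) & forall S, gen_ideal A S -> finite_set (a `&` S)]).

Lemma saturation_step_exists A Pr B W R : condition A Pr B ->
  countable A -> countable Pr -> countable B -> B R ->
  exists A', [/\ condition A' Pr B, countable A', A `<=` A' &
                 saturation_step W R Pr B A A'].
Proof.
move=> cA Ac Prc Bc BR; have iA := gen_idealP A.
have [A1 [cA1 A1c AA1 RW]] : exists A1, [/\ condition A1 Pr B, countable A1, A `<=` A1 &
    gen_ideal A1 (R `&` W) \/ exists a, [/\ A1 a, infinite_set (a `&` (R `&` W)) &
      forall S, gen_ideal A S -> finite_set (a `&` S)]].
  have [I|nI] := pselect (gen_ideal A (R `&` W)); first by exists A; split=> //; left.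
  (* Positivity here means being positive on [R]&[W], so the new member can be made to meet that
     set. *)
  have iK : ideal [set S | gen_ideal A (S `&` (R `&` W))].
    split=> [S Sfin|S T ST I|S T IS IT].
    - exact: (ideal_fin iA (finite_setIl _ Sfin)).
    - by apply: (ideal_sub iA _ I) => n [/ST].
    - by apply: (ideal_subU iA _ IS IT); set_tauto.
  have [||||a [ca _ aRW _ aI]] := @condition_extend A Pr B cA Ac Prc Bc _ setT (R `&` W)
    setT iK (cond_setT cA).
  - by rewrite /= setTI.
  - by [].
  - by [].
  - move=> Q W' P BQ PrWP I; have I' : gen_ideal A (Q `&` W').
      by apply: (ideal_sub iA _ I); set_tauto.
    by apply: (ideal_sub iA _ (cond_dense cA BQ PrWP I')); set_tauto.
  exists (a |` A); split=> //; first exact: countable_setU.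
  by right; exists a; split=> //; left.
have [CR|nCR] := pselect (cover_ideal A1 Pr B W R).
  by exists A1; split=> //; split=> //; left.
have iA1 := gen_idealP A1.
(* Here [K] is the cover ideal: thin sets are exactly what [KY], through the pair of full sets, and
   [KP] require it to contain. *)
have [|||a [ca aW _ aR aI]] := @condition_extend A1 Pr B cA1 A1c Prc Bc _ R (~` W)
  (~` W) (gen_idealP _) BR nCR.
- by [].
- move=> Q BQ I; apply: sub_gen_ideal; right; split=> //.
  exists setT, setT; split=> //; first exact: cond_pairT cA1.
  by apply: (ideal_sub iA1 _ I); set_tauto.
- move=> Q W' P BQ PrWP I; apply: sub_gen_ideal; right; split.
    exact: (cond_setI cA1 BQ (cond_pairB cA1 PrWP)).
  exists W', P; split=> //; apply: (ideal_sub iA1 _ I); set_tauto.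
exists (a |` A1); split=> //; first exact: countable_setU.
- by apply: subset_trans AA1 _ => ? ?; right.
- split.
    have [I|[b [A1b bRW bI]]] := RW; [left|right].
      by apply: gen_ideal_mono I => ? ?; right.
    by exists b; split=> //; right.
  right; exists a; split=> //; first by left.
    by apply: (sub_finite_set _ (finite_set0 _)) => n [/aW].
  by move=> S IS; apply: aI; exact: gen_ideal_mono IS.
Qed.

(** With no earlier stage to refer to, novelty of the witness becomes almost disjointness from a
    prescribed [S] in the ideal. *)
Definition saturated A Pr B W :=
  forall R S, B R -> gen_ideal A S ->
  (gen_ideal A (R `&` W) \/
     exists a, [/\ A a, finite_set (a `&` S) & infinite_set (a `&` (R `&` W))]) /\
  (cover_ideal A Pr B W R \/
     exists a, [/\ A a, finite_set (a `&` S), finite_set (a `&` W) & finite_set (a `\` R)]).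

Lemma saturation A Pr B W : condition A Pr B ->
  countable A -> countable Pr -> countable B ->
  exists A', [/\ condition A' Pr B, countable A', A `<=` A' & saturated A' Pr B W].
Proof.
move=> cA Ac Prc Bc.
have [e eB eP] := countable_enum_infinitely_often Bc (ex_intro _ _ (cond_setT cA)).
have wf : well_founded (fun i j : nat => i < j).
  by elim/ltn_ind => i IHi; constructor => j /IHi.
have [|||||i c [cc Ac'] cc'|p [p' [pE pP pmono [gG sG]]]] :=
    @chain_construction nat (set nat) (fun i j => i < j)
      [set c | condition c Pr B /\ A `<=` c] A
      (fun i c c' => saturation_step W (e i) Pr B c c') wf.
- by move=> i j; have [ij|ji|ij] := ltngtP i j; [left|right; right|right; left].
- by [].
- by split.
- by [].
- move=> C [c0 Cc0] Cg tot; split; last first.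
    by move=> a Aa; exists c0 => //; have [_] := Cg _ Cc0; apply.
  have C0 : C !=set0 by exists c0.
  have -> : Pr = \bigcup_(c in C) Pr by rewrite bigcup_const.
  have -> : B = \bigcup_(c in C) B by rewrite bigcup_const.
  apply: condition_bigcup => //; last by move=> c /Cg[].
  by move=> c d Cc Cd; have [cd|dc] := tot _ _ Cc Cd; [exists d|exists c] => //; split; split.
- have [c' [? ? cc'' ?]] := saturation_step_exists W cc cc' Prc Bc (eB i).
  by exists c'; split=> //; split=> //; exact: subset_trans cc''.
set G := A `|` _ in gG sG.
have pG i : p' i `<=` G by move=> a pa; right; exists i.
exists G; split=> //.
  by apply: countable_setU => //; apply: bigcup_countable => // i _; have [] := pP i.
move=> R S BR IS.
have GE : G = \bigcup_i p' i.
  apply/seteqP; split=> [a [Aa|//]|a]; last by right.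
  by exists 0 => //; have [_ _ + +] := pP 0; move=> /(_ _ Aa) + pp'; apply: pp'.
have pm i j : i <= j -> p' i `<=` p' j.
  rewrite leq_eqVlt => /predU1P[->//|ij]; have [_ _ _] := pP j.
  by move=> pj; exact: subset_trans (pmono _ _ ij) pj.
have [k _ Ik] : exists2 k, [set: nat] k & gen_ideal (p' k) S.
  apply: gen_ideal_bigcup; rewrite -?GE //.
  move=> i j _ _; exists (maxn i j) => //.
  by split; apply: pm; rewrite ?leq_maxl ?leq_maxr.
(* [S] is in the ideal of stage [k], and [R] is treated again at some later stage, whose witness is
   almost disjoint from [S]. *)
have [i ki ei] := eP R k.+1 BR.
have Ii : gen_ideal (p i) S by apply: gen_ideal_mono Ik; exact: pmono.
have [s1 s2] := pE i; rewrite ei in s1 s2; split.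
  have [I|[a [p'a aRW aI]]] := s1; [left|right].
    exact: gen_ideal_mono I.
  by exists a; split=> //; [exact: pG p'a | exact: aI].
have [I|[a [p'a aR aW aI]]] := s2; [left|right].
  exact: cover_ideal_mono I.
by exists a; split=> //; [exact: pG p'a | exact: aI].
Qed.

(** * Adding a partitioner *)

Lemma gen_ideal_finite A S : gen_ideal A S ->
  (forall a, A a -> finite_set (a `&` S)) -> finite_set S.
Proof.
(* Quantifying over all subsets [N] makes the property closed under unions. *)
move=> IS fS; move: (IS [set S | forall N, N `<=` S ->
  (forall a, A a -> finite_set (a `&` N)) -> finite_set N]); apply => //.
  split=> [T Tfin N NT _|T U TU LU N NT|T U LT LU N NTU fN].
  - exact: sub_finite_set Tfin.
  - exact/LU/(subset_trans NT).
  - apply: (@sub_finite_setU _ _ (N `&` T) (N `&` U)).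
    + by move=> n Nn; have [?|?] := NTU n Nn; [left|right].
    + by apply: LT => [|a /fN]; [set_tauto | apply: sub_finite_set; set_tauto].
    + by apply: LU => [|a /fN]; [set_tauto | apply: sub_finite_set; set_tauto].
by move=> a Aa N Na /(_ a Aa); apply: sub_finite_set => n Nn; split=> //; exact: Na.
Qed.

(** [J] is a finite union of members of [A] and finite sets; by almost disjointness a member is
    either one of those or almost disjoint from [J]. *)
Lemma gen_ideal_split_hull A S :
  (forall a b, A a -> A b -> a <> b -> finite_set (a `&` b)) ->
  gen_ideal A S -> exists J, [/\ gen_ideal A J, S `<=` J &
    forall a, A a -> finite_set (a `\` J) \/ finite_set (a `&` J)].
Proof.
move=> ad; have iA := gen_idealP A.
move=> /(_ [set S | exists J, [/\ gen_ideal A J, S `<=` J &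
    forall a, A a -> finite_set (a `\` J) \/ finite_set (a `&` J)]]); apply.
  split=> [T Tfin|T U TU [J [IJ UJ JP]]|T U [J [IJ TJ JP]] [K [IK UK KP]]].
  - exists T; split=> // [|a _]; first exact: (ideal_fin iA).
    by right; exact: finite_setIr.
  - by exists J; split=> //; exact: subset_trans UJ.
  - exists (J `|` K); split=> [||a Aa].
    + by have [_ _] := iA; apply.
    + exact: setUSS.
    + have [fJ|fJ] := JP a Aa; first by left; apply: sub_finite_set fJ; set_tauto.
      have [fK|fK] := KP a Aa; first by left; apply: sub_finite_set fK; set_tauto.
      by right; apply: sub_finite_setU fJ fK; set_tauto.
move=> b Ab; exists b; split=> // [|a Aa]; first exact: sub_gen_ideal.
have [->|ab] := pselect (a = b); first by left; rewrite setDv.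
by right; exact: ad.
Qed.

Section add_partitioner.
Variables (A : set (set nat)) (Pr : set (set nat * set nat)) (B : set (set nat)).
Variable W : set nat.
Hypothesis cA : condition A Pr B.
Hypotheses (Ac : countable A) (Bc : countable B).
Hypothesis sat : saturated A Pr B W.

Lemma partitioner_exists : exists P,
  [/\ finite_set (W `\` P),
      forall a, A a -> finite_set (a `&` W) -> finite_set (a `&` P),
      forall a, A a -> infinite_set (a `&` W) -> finite_set (a `\` P),
      forall Q, B Q -> gen_ideal A (Q `&` W) -> gen_ideal A (Q `&` P) &
      forall G, thin_sets A Pr B W G -> gen_ideal A (G `\` P)].
Proof.
have iA := gen_idealP A.
have /choice[jQ jQP] : forall Q, exists J, gen_ideal A (Q `&` W) ->
    [/\ gen_ideal A J, Q `&` W `<=` J &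
        forall a, A a -> finite_set (a `\` J) \/ finite_set (a `&` J)].
  move=> Q; have [I|nI] := pselect (gen_ideal A (Q `&` W)); last by exists set0.
  by have [J ?] := gen_ideal_split_hull (cond_ad cA) I; exists J.
have /choice[jG jGP] : forall G, exists J, thin_sets A Pr B W G ->
    [/\ gen_ideal A J,
        forall a, A a -> finite_set (a `\` J) \/ finite_set (a `&` J) &
        exists W' P', [/\ Pr (W', P'), G `<=` P' & (G `&` W') `\` W `<=` J]].
  move=> G; have [[BG [W' [P' [PrWP GP I]]]]|nG] := pselect (thin_sets A Pr B W G);
    last by exists set0.
  have [J [? ? ?]] := gen_ideal_split_hull (cond_ad cA) I; exists J => _.
  by split=> //; exists W', P'.
(* [P] fills the gap between [U], to be almost contained, and [V], to be almost avoided. Subtracting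
   hulls, which lie in the ideal, turns smallness modulo the ideal into finite intersections. *)
pose U := [set W] `|` [set a | A a /\ infinite_set (a `&` W)] `|`
  [set G `\` jG G | G in thin_sets A Pr B W].
pose V := [set a | A a /\ finite_set (a `&` W)] `|`
  [set Q `\` jQ Q | Q in [set Q | B Q /\ gen_ideal A (Q `&` W)]].
have Asub (D : set (set nat)) : D `<=` A -> countable D.
  by move=> DA; apply: sub_countable Ac; exact: subset_card_le.
have Bsub (D : set (set nat)) f : D `<=` B -> countable [set f Q | Q in D].
  move=> DB; apply: sub_countable (card_image_le _ _) _.
  by apply: sub_countable Bc; exact: subset_card_le.
have [||S T|P [PU PV]] := @gap_interpolation U V.
- apply: countable_setU; last by apply: Bsub => G [].
  by apply: countable_setU => //; apply: Asub => a [].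
- by apply: countable_setU; [apply: Asub => a [] | apply: Bsub => Q []].
- have aQ a Q : A a -> B Q -> gen_ideal A (Q `&` W) -> infinite_set (a `&` W) ->
      finite_set (a `&` (Q `\` jQ Q)).
    move=> Aa BQ /jQP[_ QJ /(_ a Aa)[fJ|fJ]] aW.
      by apply: sub_finite_set fJ; set_tauto.
    have [fQ|fQ] := cond_dec cA Aa BQ; last by apply: sub_finite_set fQ; set_tauto.
    exfalso; apply: aW; apply: (sub_finite_setU _ fQ fJ) => n [an Wn].
    by have [Qn|nQ] := EM (Q n); [right; split=> //; exact: QJ | left].
  (* If [a] were almost contained in [G] and almost disjoint from the hull, it would be almost
     disjoint from [W'], hence from [P'], which contains [G]. *)
  have Ga G a : thin_sets A Pr B W G -> A a -> finite_set (a `&` W) ->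
      finite_set ((G `\` jG G) `&` a).
    move=> tG Aa aW; have [_ /(_ a Aa)[fJ|fJ] [W' [P' [PrWP GP GJ]]]] := jGP G tG.
      by apply: sub_finite_set fJ; set_tauto.
    have [fG|fG] := cond_dec cA Aa (proj1 tG); last first.
      by apply: sub_finite_set fG; set_tauto.
    exfalso; apply: (cond_inf cA Aa).
    have aP : finite_set (a `&` P').
      apply: (cond_hit cA Aa PrWP); apply: (sub_finite_setU3 _ fG aW fJ) => n [an W'n].
      have [Gn|nG] := EM (G n); last by left; left.
      have [Wn|nW] := EM (W n); first by left; right.
      by right; split=> //; apply: GJ.
    apply: (sub_finite_setU _ fG aP) => n an.
    by have [Gn|nG] := EM (G n); [right; split=> //; exact: GP | left].
  (* The density invariant for [(W', P')] puts [Q]&[G] in the ideal; finiteness off the hulls is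
     then tested on each member of [A]. *)
  have GQ G Q : thin_sets A Pr B W G -> B Q -> gen_ideal A (Q `&` W) ->
      finite_set ((G `\` jG G) `&` (Q `\` jQ Q)).
    move=> tG BQ IQ; have [IG fG [W' [P' [PrWP GP GJ]]]] := jGP G tG.
    have [IQ' QJ fQ] := jQP Q IQ.
    have BQG := cond_setI cA BQ (proj1 tG).
    have QGJ : Q `&` G `&` W' `<=` jG G `|` jQ Q.
      move=> n [[Qn Gn] W'n]; have [Wn|nW] := EM (W n); first by right; exact: QJ.
      by left; exact: GJ.
    have IQG := cond_dense cA BQG PrWP (ideal_subU iA QGJ IG IQ').
    apply: (gen_ideal_finite (A := A)).
      by apply: (ideal_sub iA _ IQG) => n [[Gn _] [Qn _]]; split=> //; exact: GP.
    move=> a Aa.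
    have [fJ|fJ] := fG a Aa; first by apply: sub_finite_set fJ; set_tauto.
    have [fJ'|fJ'] := fQ a Aa; first by apply: sub_finite_set fJ'; set_tauto.
    have [fQG|fQG] := cond_dec cA Aa BQG; last by apply: sub_finite_set fQG; set_tauto.
    have : finite_set (a `&` P').
      apply: (cond_hit cA Aa PrWP); apply: (sub_finite_setU3 _ fQG fJ fJ') => n [an W'n].
      have [QGn|nQG] := EM ((Q `&` G) n); last by left; left.
      by have [?|?] := QGJ n (conj QGn W'n); [left; right | right].
    by apply: sub_finite_set => n [an [[Gn _] _]]; split=> //; exact: GP.
  move=> [[->|[Aa aW]]|[G tG <-]] [[Ab bW]|[Q [BQ IQ] <-]].
  + by rewrite setIC.
  + have [_ QJ _] := jQP Q IQ.
    by apply: (sub_finite_set _ (finite_set0 _)) => n [Wn [Qn]]; apply; exact: QJ.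
  + by apply: (cond_ad cA) => // ST; apply: aW; rewrite ST.
  + exact: aQ.
  + exact: Ga.
  + exact: GQ.
exists P; split.
- by apply: PU; left; left.
- by move=> a Aa aW; apply: PV; left.
- by move=> a Aa aW; apply: PU; left; right.
- move=> Q BQ IQ; have [IJ _ _] := jQP Q IQ.
  have fP : finite_set ((Q `\` jQ Q) `&` P) by apply: PV; right; exists Q.
  by apply: (ideal_subU iA _ (ideal_fin iA fP) IJ); set_tauto_by (jQ Q).
- move=> G tG; have [IJ _ _] := jGP G tG.
  have fP : finite_set ((G `\` jG G) `\` P) by apply: PU; right; exists G.
  by apply: (ideal_subU iA _ (ideal_fin iA fP) IJ); set_tauto_by (jG G).
Qed.

(** The elements of the algebra generated by [B] and [P] agree with some [Q] on [P] and some [R] off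
    [P]. Saturation yields the density invariant for the old pairs. *)
Lemma condition_add_partitioner : exists P B',
  [/\ condition A ((W, P) |` Pr) B', countable B' & B `<=` B'].
Proof.
have iA := gen_idealP A.
have [P [WP fP iP QP GP]] := partitioner_exists.
have cover_P R : cover_ideal A Pr B W R -> gen_ideal A (R `\` P).
  move=> /(_ [set S | gen_ideal A (S `\` P)]); apply.
    split=> [T Tfin|T U TU IU|T U IT IU].
    - exact: (ideal_fin iA (finite_setD _ Tfin)).
    - by apply: (ideal_sub iA _ IU) => n [/TU].
    - by apply: (ideal_subU iA _ IT IU); set_tauto.
  move=> S [AS|/GP//]; apply: (ideal_sub iA _ (sub_gen_ideal AS)); set_tauto.
pose mix Q R := (Q `&` P) `|` (R `\` P).
pose B' := [set mix qr.1 qr.2 | qr in B `*` B].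
have B'P Q R : B Q -> B R -> B' (mix Q R) by move=> BQ BR; exists (Q, R).
have mixid Q : mix Q Q = Q.
  by apply/seteqP; split; rewrite /mix; set_tauto_by P.
have BB' : B `<=` B' by move=> Q BQ; rewrite -(mixid Q); exact: B'P.
exists P, B'; split=> //; last first.
  by apply: sub_countable (card_image_le _ _) _; exact: countableX.
have BT := cond_setT cA.
split.
- exact: cond_inf cA.
- exact: cond_ad cA.
- exact: BB'.
- move=> _ _ [[Q1 R1] [/= BQ1 BR1] <-] [[Q2 R2] [/= BQ2 BR2] <-].
  have -> : mix Q1 R1 `&` mix Q2 R2 = mix (Q1 `&` Q2) (R1 `&` R2).
    by apply/seteqP; split; rewrite /mix; set_tauto.
  by apply: B'P; exact: (cond_setI cA).
- move=> _ [[Q R] [/= BQ BR] <-].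
  have -> : ~` mix Q R = mix (~` Q) (~` R).
    by apply/seteqP; split; rewrite /mix; set_tauto_by P.
  by apply: B'P; exact: (cond_setC cA).
- move=> V S [[_ ->]|/(cond_pairB cA)/BB'//].
  have -> : P = mix setT (~` setT).
    by apply/seteqP; split; rewrite /mix; set_tauto.
  by apply: B'P => //; exact: (cond_setC cA).
- by move=> V S [[-> ->]//|/(cond_pair_sub cA)].
- by right; exact: cond_pairT cA.
- move=> a _ Aa [[Q R] [/= BQ BR] <-]; rewrite /mix.
  have [fW|iW] := pselect (finite_set (a `&` W)).
    have aP := fP a Aa fW.
    have [fR|fR] := cond_dec cA Aa BR; [left|right];
      by apply: (sub_finite_setU _ fR aP); set_tauto_by P.
  have aP := iP a Aa iW.
  have [fQ|fQ] := cond_dec cA Aa BQ; [left|right];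
    by apply: (sub_finite_setU _ fQ aP); set_tauto_by P.
- by move=> a V S Aa [[-> ->]|]; [exact: fP | exact: (cond_hit cA Aa)].
- move=> _ V S [[Q R] [/= BQ BR] <-] [[-> ->] I|PrVS I].
    have IQ : gen_ideal A (Q `&` W).
      by apply: (ideal_subU iA _ I (ideal_fin iA WP)); rewrite /mix; set_tauto_by P.
    by apply: (ideal_sub iA _ (QP Q BQ IQ)); rewrite /mix; set_tauto.
  have BS := cond_pairB cA PrVS.
  (* Otherwise saturation gives a member [a] meeting [Q]&[S]&[W] infinitely often and almost
     disjoint from [mix Q R]&[V]. Being almost inside [P] and [Q], it is almost disjoint from [V],
     hence from [S]: a contradiction. *)
  have IQ : gen_ideal A (Q `&` S `&` P).
    have BQS := cond_setI cA BQ BS.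
    have [[/(QP _ BQS)//|[a [Aa aI aW]]] _] := sat BQS I.
    exfalso; have aP : finite_set (a `\` P).
      by apply: iP => // fW; apply: aW; apply: sub_finite_set fW; set_tauto.
    have [fQ|fQ] := cond_dec cA Aa BQS; last first.
      by apply: aW; apply: sub_finite_set fQ; set_tauto.
    have : finite_set (a `&` S).
      apply: (cond_hit cA Aa PrVS); apply: (sub_finite_setU3 _ aI fQ aP).
      rewrite /mix; move=> n; have := EM (P n); have := EM (Q n); have := EM (S n).
      by rewrite /setD /setI /setU /mkset /=; tauto.
    by move=> aS; apply: aW; apply: sub_finite_set aS; set_tauto.
  (* The same off [P], with the cover ideal: a witness would be almost contained in [R]&[S] and
     almost disjoint from [P], hence from [V] and [S]. *)
  have IR : gen_ideal A ((R `&` S) `\` P).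
    have BRS := cond_setI cA BR BS.
    have [_ [/cover_P//|[a [Aa aI aW aR]]]] := sat BRS I.
    exfalso; apply: (cond_inf cA Aa); have aP := fP a Aa aW.
    have aS : finite_set (a `&` S).
      apply: (cond_hit cA Aa PrVS); apply: (sub_finite_setU3 _ aI aR aP).
      rewrite /mix; move=> n; have := EM (P n); have := EM (R n); have := EM (S n).
      by rewrite /setD /setI /setU /mkset /=; tauto.
    by apply: (sub_finite_setU _ aR aS); set_tauto_by S.
  by apply: (ideal_subU iA _ IQ IR); rewrite /mix; set_tauto.
- exact: cond_proper cA.
Qed.

End add_partitioner.

(** * The construction *)

Lemma well_ordering (T : eqType) : exists lt : T -> T -> Prop,
  well_founded lt /\ forall x y, lt x y \/ x = y \/ lt y x.
Proof.
have [R Rwo] := well_ordering_principle T.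
have Rxx x : R x x.
  have [|z [[]]] := Rwo (pred1 x); first by exists x; rewrite inE.
  by rewrite inE => /eqP-> + _; apply; rewrite inE.
exists (fun x y => ~~ R y x); split=> [x|x y].
  apply: contrapT => nx.
  have [|z [[]]] := Rwo [pred y | `[< ~ Acc (fun x y => ~~ R y x) y >]].
    by exists x; apply/asboolP.
  move=> /asboolP nz zmin _; apply: nz; constructor => y zy.
  by apply: contrapT => ny; move: zy; rewrite zmin //; apply/asboolP.
have [xy|] := boolP (R x y); last by right; right.
have [yx|] := boolP (R y x); last by left.
right; left; have [|z [_ zuniq]] := Rwo (pred2 x y).
  by exists x; rewrite !inE eqxx.
by rewrite -(zuniq x) ?(zuniq y) //; split; rewrite ?inE ?eqxx ?orbT //;
  move=> w /pred2P[]->.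
Qed.

(** In a well-order of the power set, take the least uncountable initial segment, or everything if
    there is none. Under CH it has the size of the continuum, and its own segments are countable. *)
Lemma CH_enumeration : continuum_hypothesis ->
  exists (I : Type) (lt : I -> I -> Prop) (e : I -> set nat),
  [/\ well_founded lt, forall i j, lt i j \/ i = j \/ lt j i,
      forall i, countable [set j | lt j i] & forall W, exists i, e i = W].
Proof.
move=> CH; have [lt [wf tri]] := well_ordering (set nat).
pose seg x := [set y | lt y x].
have [S [Sseg ST]] : exists S : set (set nat),
    (forall x, S x -> countable (seg x)) /\ (S #= [set: set nat])%card.
  have [all_c|nc] := pselect (forall x, countable (seg x)).
    by exists setT; split=> //; exact: card_eqxx.
  have [x] : exists x, ~ countable (seg x) /\ forall y, lt y x -> countable (seg y).
    apply: contrapT => nx; apply: nc; elim/(well_founded_ind wf) => x IHx.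
    by apply: contrapT => nsx; apply: nx; exists x.
  by move=> [nsx xmin]; exists (seg x); split=> //; have [|] := CH (seg x).
have /pcard_geP/surjPex[f fS] : ([set: set nat] #<= S)%card.
  by move: ST; rewrite card_eq_le => /andP[].
exists (set_type S), (fun i j => lt (val i) (val j)), (fun i => f (val i)).
split.
- suff wfS x : Acc lt x -> forall i : S, val i = x ->
      Acc (fun i j : S => lt (val i) (val j)) i.
    by move=> i; exact: (wfS _ (wf (val i)) i erefl).
  elim=> y _ IH i iy; constructor => j ji.
  by apply: (IH (val j)) => //; rewrite -iy.
- move=> i j; have [|[|]] := tri (val i) (val j); [by left| |by right; right].
  by move=> /val_inj->; right; left.
- move=> i; have /countable_injP[g ginj] := Sseg _ (set_valP i).
  apply/countable_injP; exists (fun j => g (val j)) => j k /set_mem ji /set_mem ki gjk.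
  by apply/val_inj/ginj; rewrite ?inE.
- move=> W; have [x Sx fx] := fS W I.
  by exists (SigSub (mem_set Sx)).
Qed.

(** * Almost-normality of the Psi-space from partitioners *)

Section Psi_space.
Variable F : set (set nat).
Implicit Types (C D : set (Psi F)).

Lemma closed_Psi_inr C (A : F) : closed C ->
  infinite_set (val A `&` [set n | C (inl n)]) -> C (inr A).
Proof.
move=> /closure_id CE inf; rewrite CE => U [E Efin EU].
have [n [[An Cn] nE]] : (val A `&` [set n | C (inl n)] `\` E) !=set0.
  by apply/infinite_setN0/infinite_setD.
by exists (inl n); split=> //; apply: EU; right; exists n.
Qed.

Lemma regclosed_Psi_inr C (A : F) : infinite_set (val A) -> regclosed C ->
  C (inr A) -> infinite_set (val A `&` [set n | C (inl n)]).
Proof.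
move=> Ainf CE; rewrite -{1}CE => clC fin.
(* This neighborhood omits the trace of [C], so it can meet the interior only at [A] itself; then
   almost all of [val A] lies in the trace. *)
have [|p [ip]] := clC ([set inr A] `|`
    [set inl n | n in val A `\` (val A `&` [set n | C (inl n)])]).
  by exists (val A `&` [set n | C (inl n)]).
move=> pN; case: pN ip => [-> ip|[n [An nC] <-] ip]; last first.
  by apply: nC; split=> //; exact: interior_subset ip.
have [E Efin EC] := ip; apply: Ainf.
apply: (sub_finite_set (B := (val A `&` [set n | C (inl n)]) `|` E)); last first.
  by rewrite finite_setU.
move=> n An; have [En|nE] := EM (E n); [by right | left; split=> //].
by apply: EC; right; exists n.
Qed.

Lemma separate_regclosed_Psi C D :
  (forall A, F A -> infinite_set A) ->
  (forall W, exists P, forall A, F A ->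
     (finite_set (A `&` W) -> finite_set (A `&` P)) /\
     (infinite_set (A `&` W) -> finite_set (A `\` P))) ->
  closed C -> closed D -> C `&` D = set0 -> regclosed C ->
  exists U V : set (Psi F),
    [/\ open U, open V, C `<=` U, D `<=` V & U `&` V = set0].
Proof.
move=> Finf part cC cD CD0 rC.
have CD p : C p -> D p -> False.
  by move=> Cp Dp; have : (C `&` D) p by []; rewrite CD0.
pose W := [set n | C (inl n)]; pose E := [set n | D (inl n)].
have [P PP] := part W.
have CW (A : F) : C (inr A) <-> infinite_set (val A `&` W).
  split; last exact: closed_Psi_inr.
  by apply: regclosed_Psi_inr => //; exact/Finf/set_valP.
(* Adding [W] captures the isolated points of [C] and removing [E] leaves out those of [D]; the
   resulting [U] is clopen. *)
pose Q := (P `|` W) `\` E.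
pose U : set (Psi F) := fun p => match p with inl n => Q n | inr A => C (inr A) end.
exists U, (~` U); split.
- rewrite openE => -[n //|A CA]; have [_ AP] := PP _ (set_valP A).
  exists (val A `\` Q); last first.
    move=> _ [->//|[n [An nQ] <-]] /=; apply: contrapT => nQn; exact: nQ.
  have AE : finite_set (val A `&` E).
    apply: contrapT => inf; apply: (CD _ CA); exact: closed_Psi_inr.
  apply: (sub_finite_setU _ (AP ((CW A).1 CA)) AE) => n [An nQ].
  have [En|nE] := EM (E n); first by right.
  by left; split=> // Pn; apply: nQ; split=> //; left.
- rewrite openE => -[n //|A nCA]; have [AP _] := PP _ (set_valP A).
  exists (val A `&` Q); last first.
    by move=> _ [->//|[n [An nQ] <-]] Qn; apply: nQ.
  have AW : finite_set (val A `&` W) by apply: contrapT => /(CW A).2.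
  by apply: (sub_finite_setU _ (AP AW) AW); rewrite /Q; set_tauto.
- by move=> [n Cn|//]; split; [right | move=> /(CD _ Cn)].
- move=> [n Dn [_]|A DA CA]; first exact.
  exact: CD CA DA.
- exact: setICr.
Qed.

Lemma almost_normal_Psi :
  (forall A, F A -> infinite_set A) ->
  (forall W, exists P, forall A, F A ->
     (finite_set (A `&` W) -> finite_set (A `&` P)) /\
     (infinite_set (A `&` W) -> finite_set (A `\` P))) ->
  almost_normal (Psi F).
Proof.
move=> Finf part C D cC cD CD0 [rC|rD].
  exact: separate_regclosed_Psi.
rewrite setIC in CD0.
have [U [V [oU oV DU CV UV]]] := separate_regclosed_Psi Finf part cD cC CD0 rD.
by exists V, U; split=> //; rewrite setIC.
Qed.

End Psi_space.

(** * Coded conditions and the main induction *)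

(* A condition is coded by a single set so that unions of chains make sense. *)
Definition coded : Type := (set nat + (set nat * set nat) + set nat)%type.

Definition coded_condition (c : set coded) :=
  condition [set a | c (inl (inl a))] [set WP | c (inl (inr WP))] [set Q | c (inr Q)].

Definition code A Pr B : set coded := fun x => match x with
  | inl (inl a) => A a | inl (inr WP) => Pr WP | inr Q => B Q end.

Lemma countable_code A Pr B :
  countable A -> countable Pr -> countable B -> countable (code A Pr B).
Proof.
move=> Ac Prc Bc.
have -> : code A Pr B = [set inl (inl a) | a in A] `|` [set inl (inr p) | p in Pr] `|`
    [set inr Q | Q in B].
  apply/seteqP; split=> [[[a|p]|Q] /= h|x].
  - by left; left; exists a.
  - by left; right; exists p.
  - by right; exists Q.
  - by move=> [[|]|] [y yP <-].
have im (T U : Type) (f : T -> U) (X : set T) : countable X -> countable (f @` X).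
  exact: sub_countable (card_image_le _ _).
by apply: countable_setU; [apply: countable_setU|]; exact: im.
Qed.

Lemma countable_preimage (T U : Type) (f : T -> U) (X : set U) :
  injective f -> countable X -> countable (f @^-1` X).
Proof.
move=> finj /countable_injP[g ginj]; apply/countable_injP; exists (g \o f).
by move=> x y /set_mem Xx /set_mem Xy /ginj fxy; apply: finj; apply: fxy; rewrite inE.
Qed.

Lemma condition_base : condition set0 [set (setT, setT)] [set setT; set0].
Proof.
split => //.
- by left.
- by move=> Q R [->|->] [->|->]; rewrite ?setIT ?setI0 ?set0I /=; tauto.
- by move=> Q [->|->]; rewrite ?setCT ?setC0 /=; tauto.
- by move=> W P [_ ->]; left.
- by move=> W P [-> ->]; rewrite setDv.
- by move=> Q W P _ [-> ->].
- move=> /(_ finite_set) fT; apply: infinite_nat; apply: fT => //.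
  split=> // [S T ST|S T fS fT]; first exact: sub_finite_set.
  by rewrite finite_setU.
Qed.

Lemma coded_condition_extend W c : coded_condition c -> countable c ->
  exists c', [/\ coded_condition c', countable c', c `<=` c' &
    (exists P, c' (inl (inr (W, P)))) /\
    (infinite_set W -> exists2 a, c' (inl (inl a)) & infinite_set (a `&` W))].
Proof.
move=> cc Cc; rewrite /coded_condition in cc.
set A := [set a | _] in cc; set Pr := [set WP | _] in cc; set B := [set Q | _] in cc.
have Ac : countable A by apply: (countable_preimage _ Cc) => x y [].
have Prc : countable Pr by apply: (countable_preimage _ Cc) => x y [].
have Bc : countable B by apply: (countable_preimage _ Cc) => x y [].
have [A' [cA' A'c AA' sat]] := saturation W cc Ac Prc Bc.
have [P [B' [cB' B'c BB']]] := condition_add_partitioner cA' A'c Bc sat.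
exists (code A' ((W, P) |` Pr) B'); split.
- exact: cB'.
- by apply: countable_code => //; exact: countable_setU.
- by move=> [[a /AA'|p ?]|Q /BB'] //; right.
- split=> [|Winf]; first by exists P; left.
  have I0 : gen_ideal A' set0 by apply: (ideal_fin (gen_idealP _)).
  (* Either [W] is in the ideal, and being infinite it meets some member infinitely often, or
     saturation supplies such a member. *)
  have [[I|[a [A'a _ aW]]] _] := sat setT set0 (cond_setT cA') I0.
    apply: contrapT => na; apply: Winf; rewrite setTI in I.
    apply: (gen_ideal_finite I) => a A'a; apply: contrapT => aW.
    by apply: na; exists a.
  by exists a => //; move: aW; rewrite setTI.
Qed.

Lemma gen_ideal_bigcup_finite F : finite_set F -> gen_ideal F (\bigcup_(a in F) a).
Proof.
move=> /finite_seqP[s ->]; have iF := gen_idealP [set` s].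
rewrite bigcup_seq big_seq; elim/big_ind: _ => [|S T|a sa].
- exact: (ideal_fin iF).
- by have [_ _] := iF; apply.
- exact: sub_gen_ideal.
Qed.

Theorem theorem2p7 (CH : continuum_hypothesis) :
  exists F : set (set nat), MAD_family F /\ almost_normal (Psi F).
Proof.
have [I [lt [e [wf tri seg eW]]]] := CH_enumeration CH.
have [||C C0 Cg tot|i c gc cc|p [p' [pE _ _ gG]]] := @chain_construction I coded lt
  coded_condition (code set0 [set (setT, setT)] [set setT; set0])
  (fun i _ c' => (exists P, c' (inl (inr (e i, P)))) /\
    (infinite_set (e i) -> exists2 a, c' (inl (inl a)) & infinite_set (a `&` e i)))
  wf tri seg.
- exact: condition_base.
- by apply: countable_code => //; exact: countable_setU.
- apply: (condition_bigcup (A := fun c a => c (inl (inl a)))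
    (Pr := fun c WP => c (inl (inr WP))) (B := fun c Q => c (inr Q)) C0) => // c d Cc Cd.
  by have [cd|dc] := tot c d Cc Cd; [exists d|exists c] => //; split; split=> // x;
    [exact: cd|exact: cd|exact: cd|exact: dc|exact: dc|exact: dc].
- exact: coded_condition_extend.
set G := _ `|` _ in gG.
have pG i : p' i `<=` G by move=> x px; right; exists i.
pose F : set (set nat) := [set a | G (inl (inl a))].
have hit W : infinite_set W -> exists2 a, F a & infinite_set (a `&` W).
  move=> Winf; have [i ei] := eW W; have [_ ] := pE i; rewrite ei => /(_ Winf)[a pa aW].
  by exists a => //; exact: pG pa.
have part W : exists P, G (inl (inr (W, P))).
  by have [i ei] := eW W; have [[P pP] _] := pE i; exists P; apply: (pG i); rewrite -ei.
exists F; split.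
  split.
  (* Were [F] finite, its union would be in the ideal with a finite complement, as [hit] leaves no
     infinite set disjoint from it. *)
  - move=> Ffin; apply: (cond_proper gG).
    have IF := gen_ideal_bigcup_finite Ffin.
    have IC : gen_ideal F (~` \bigcup_(a in F) a).
      apply: (ideal_fin (gen_idealP F)); apply: contrapT => /hit[a Fa]; apply.
      by apply: (sub_finite_set _ (finite_set0 _)) => n [an]; apply; exists a.
    by apply: (ideal_subU (gen_idealP F) _ IF IC); rewrite setUCr.
  - by split=> [a|a b]; [exact: (cond_inf gG) | exact: (cond_ad gG)].
  - move=> H [Hinf Had] FH; apply/seteqP; split=> // b Hb.
    have [a Fa ab] := hit b (Hinf b Hb).
    have [<-//|nab] := pselect (a = b).
    by case: ab; apply: Had => //; exact: FH.
apply: almost_normal_Psi => [a|W]; first exact: (cond_inf gG).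
have [P GP] := part W; exists P => a Fa; split; first exact: (cond_hit gG).
(* As [W] is almost contained in [P], a member meeting [W] infinitely often cannot be almost
   disjoint from [P]. *)
move=> aW; have [//|aP] := cond_dec gG Fa (cond_pairB gG GP).
exfalso; apply: aW; apply: (sub_finite_setU _ (cond_pair_sub gG GP) aP); set_tauto_by P.
Qed.
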